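(* Let $\mathcal{C}$ be a fusion category over a field $\Bbbk$, and let $\mathcal{D}\subset\mathcal{C}$ be a normal fusion subcategory of $\mathcal{C}$. Denote by $F:\mathcal{C}\to\tilde{\mathcal{C}}$ a tensor functor between fusion categories such that $\mathcal{D}=\mathfrak{Ker}_F$. Let $\mathcal{E}$ be the full abelian subcategory of $\mathcal{C}$ generated by the simple objects $X$ of $\mathcal{C}$ such that $F(X)=M^n$ (up to isomorphism), with $M$ invertible and $n\geq 0$. Then $$\mathcal{D}^{co}=\mathrm{rad}_{\mathcal{C}}(\mathcal{D})=\mathcal{E}.$$ In particular, $\mathcal{D}^{co}$ and $\mathrm{rad}_{\mathcal{C}}(\mathcal{D})$ are fusion subcategories of $\mathcal{C}$.
   Context: A fusion category over a field $\Bbbk$ is a $\Bbbk$-linear semisimple rigid monoidal category with finitely many isomorphism classes of simple objects, finite dimensional Hom spaces, such that $\mathrm{End}(S)=\Bbbk$ for every simple object $S$, and whose unit object $\mathbf{1}$ is simple. A fusion subcategory is a full replete monoidal subcategory which is itself a fusion category. An object is trivial if isomorphic to $\mathbf{1}^n$ for some $n\in\mathbb{N}$. A tensor functor is a strong monoidal $\Bbbk$-linear functor. The kernel $\mathfrak{Ker}_F\subset\mathcal{C}$ of a tensor functor $F:\mathcal{C}\to\tilde{\mathcal{C}}$ is the fusion subcategory of all objects $X$ such that $F(X)$ is trivial. $F$ is normal if for every simple object $X$ of $\mathcal{C}$ such that $F(X)$ contains $\mathbf{1}$ as a direct summand, $F(X)$ is trivial. A fusion subcategory $\mathcal{D}\subset\mathcal{C}$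 is normal if $\mathcal{D}=\mathfrak{Ker}_F$ for some normal tensor functor $F$ from $\mathcal{C}$ to a fusion category. For a fusion subcategory $\mathcal{D}\subset\mathcal{C}$: the radical $\mathrm{rad}_{\mathcal{C}}(\mathcal{D})$ is the full abelian subcategory of $\mathcal{C}$ generated by the simple objects $X$ such that $X^{\otimes n}$ belongs to $\mathcal{D}$ for some integer $n>0$; the commutator $\mathcal{D}^{co}$ is the full abelian subcategory of $\mathcal{C}$ generated by the simple objects $X$ such that $X\otimes X^*$ belongs to $\mathcal{D}$. Here the full abelian subcategory generated by a set of simple objects is the full subcategory of finite direct sums of objects isomorphic to members of that set. *)

(* Defs.v *)
From HB Require Import structures.
From mathcomp Require Import all_boot all_algebra.

Set Implicit Arguments.
Unset Strict Implicit.
Unset Printing Implicit Defensive.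

Import GRing.Theory.
Local Open Scope ring_scope.

Declare Scope cat_scope.
Delimit Scope cat_scope with cat.

Reserved Notation "g \oc f" (at level 50, left associativity).
Reserved Notation "X \ox Y" (at level 40, left associativity).
Reserved Notation "f \ot g" (at level 40, left associativity).

(* Finite dimensionality of the Hom spaces is part of [vectType]. *)
Record linCat (k : fieldType) := LinCat {
  obj :> Type;
  Hom : obj -> obj -> vectType k;
  ident : forall X, Hom X X;
  mcomp : forall X Y Z, Hom Y Z -> Hom X Y -> Hom X Z;
  mcomp1m : forall X Y (f : Hom X Y), mcomp (ident Y) f = f;
  mcompm1 : forall X Y (f : Hom X Y), mcomp f (ident X) = f;
  mcompA : forall W X Y Z (h : Hom Y Z) (g : Hom X Y) (f : Hom W X),
    mcomp h (mcomp g f) = mcomp (mcomp h g) f;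
  mcomp_linearr : forall X Y Z (g : Hom Y Z),
    linear (fun f : Hom X Y => mcomp g f);
  mcomp_linearl : forall X Y Z (f : Hom X Y),
    linear (fun g : Hom Y Z => mcomp g f)
}.

Arguments Hom {k l} X Y.
Arguments ident {k l} X.
Arguments mcomp {k l X Y Z} g f.

Notation "g \oc f" := (mcomp g f) : cat_scope.
Local Open Scope cat_scope.

Section LinCat.
Variables (k : fieldType) (C : linCat k).
Implicit Types X Y Z : C.

Definition inverse X Y (f : Hom X Y) (g : Hom Y X) : Prop :=
  g \oc f = ident X /\ f \oc g = ident Y.

Definition is_iso X Y (f : Hom X Y) : Prop := exists g, inverse f g.

Definition iso X Y : Prop := exists f : Hom X Y, is_iso f.

Definition mono X Y (f : Hom X Y) : Prop :=
  forall T (u v : Hom T X), f \oc u = f \oc v -> u = v.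

Definition epi X Y (f : Hom X Y) : Prop :=
  forall T (u v : Hom Y T), u \oc f = v \oc f -> u = v.

(* Both initial and terminal; Hom spaces are never empty here. *)
Definition is_zero X : Prop :=
  (forall Y (f g : Hom X Y), f = g) /\ (forall Y (f g : Hom Y X), f = g).

(* [is_dsum Y X]: X is a direct sum (biproduct) of the finite family Y. When the
   family is empty this says that X is a zero object. *)
Definition is_dsum (I : finType) (Y : I -> C) X : Prop :=
  exists (p : forall i, Hom X (Y i)) (q : forall i, Hom (Y i) X),
    [/\ forall i, p i \oc q i = ident (Y i),
        forall i j, i != j -> p i \oc q j = 0
      & \sum_i (q i \oc p i) = ident X].

Definition is_multiple (n : nat) (M X : C) : Prop :=
  is_dsum (fun _ : 'I_n => M) X.

Definition direct_summand X Y : Prop :=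
  exists Z, is_dsum (fun b : bool => if b then X else Z) Y.

Definition is_kernel X Y (f : Hom X Y) K (i : Hom K X) : Prop :=
  f \oc i = 0 /\
  forall T (t : Hom T X), f \oc t = 0 -> exists! u : Hom T K, i \oc u = t.

Definition is_cokernel X Y (f : Hom X Y) Q (p : Hom Y Q) : Prop :=
  p \oc f = 0 /\
  forall T (t : Hom Y T), t \oc f = 0 -> exists! u : Hom Q T, u \oc p = t.

Definition additive_cat : Prop :=
  forall (I : finType) (Y : I -> C), exists X, is_dsum Y X.

Record abelian_cat : Prop := {
  abelian_additive : additive_cat;
  abelian_kernel : forall X Y (f : Hom X Y),
    exists K (i : Hom K X), is_kernel f i;
  abelian_cokernel : forall X Y (f : Hom X Y),
    exists Q (p : Hom Y Q), is_cokernel f p;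
  abelian_mono : forall K X (i : Hom K X), mono i ->
    exists Y (f : Hom X Y), is_kernel f i;
  abelian_epi : forall Y Q (p : Hom Y Q), epi p ->
    exists X (f : Hom X Y), is_cokernel f p
}.

Definition simple_obj X : Prop :=
  ~ is_zero X /\
  forall Y (f : Hom Y X), mono f -> is_zero Y \/ is_iso f.

Definition semisimple_cat : Prop :=
  abelian_cat /\
  forall X, exists n (Y : 'I_n -> C), (forall i, simple_obj (Y i)) /\ is_dsum Y X.

Definition finitely_many_simples : Prop :=
  exists n (S : 'I_n -> C), forall X, simple_obj X -> exists i, iso X (S i).

(* A full subcategory is given by its class of objects. *)
Definition replete (P : C -> Prop) : Prop :=
  forall X Y, iso X Y -> P X -> P Y.

Definition generated_by (Q : C -> Prop) X : Prop :=
  exists n (Y : 'I_n -> C),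
    (forall i, exists S, [/\ simple_obj S, Q S & iso (Y i) S]) /\ is_dsum Y X.

End LinCat.

Record monCat (k : fieldType) := MonCat {
  mcat :> linCat k;
  tobj : mcat -> mcat -> mcat;
  thom : forall X X' Y Y' : mcat,
    Hom X X' -> Hom Y Y' -> Hom (tobj X Y) (tobj X' Y');
  thom_id : forall X Y, thom (ident X) (ident Y) = ident (tobj X Y);
  thom_comp : forall X X' X'' Y Y' Y''
    (g : Hom X' X'') (f : Hom X X') (g' : Hom Y' Y'') (f' : Hom Y Y'),
    thom (g \oc f) (g' \oc f') = thom g g' \oc thom f f';
  thom_linearl : forall X X' Y Y' (g : Hom Y Y'),
    linear (fun f : Hom X X' => thom f g);
  thom_linearr : forall X X' Y Y' (f : Hom X X'),
    linear (fun g : Hom Y Y' => thom f g);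
  unit_obj : mcat;
  assoc : forall X Y Z, Hom (tobj (tobj X Y) Z) (tobj X (tobj Y Z));
  assocV : forall X Y Z, Hom (tobj X (tobj Y Z)) (tobj (tobj X Y) Z);
  assocK : forall X Y Z, inverse (assoc X Y Z) (assocV X Y Z);
  assoc_nat : forall X X' Y Y' Z Z'
    (f : Hom X X') (g : Hom Y Y') (h : Hom Z Z'),
    assoc X' Y' Z' \oc thom (thom f g) h = thom f (thom g h) \oc assoc X Y Z;
  lunit : forall X, Hom (tobj unit_obj X) X;
  lunit_iso : forall X, is_iso (lunit X);
  lunit_nat : forall X Y (f : Hom X Y),
    lunit Y \oc thom (ident unit_obj) f = f \oc lunit X;
  runit : forall X, Hom (tobj X unit_obj) X;
  runit_iso : forall X, is_iso (runit X);
  runit_nat : forall X Y (f : Hom X Y),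
    runit Y \oc thom f (ident unit_obj) = f \oc runit X;
  pentagon : forall W X Y Z,
    assoc W X (tobj Y Z) \oc assoc (tobj W X) Y Z =
    thom (ident W) (assoc X Y Z) \oc assoc W (tobj X Y) Z
      \oc thom (assoc W X Y) (ident Z);
  triangle : forall X Y,
    thom (ident X) (lunit Y) \oc assoc X unit_obj Y = thom (runit X) (ident Y)
}.

Arguments tobj {k m} X Y.
Arguments thom {k m X X' Y Y'} f g.
Arguments unit_obj {k} m.
Arguments assoc {k m} X Y Z.
Arguments assocV {k m} X Y Z.
Arguments lunit {k m} X.
Arguments runit {k m} X.

Notation "X \ox Y" := (tobj X Y) : cat_scope.
Notation "f \ot g" := (thom f g) : cat_scope.

Section MonCat.
Variables (k : fieldType) (C : monCat k).
Implicit Types X Y M : C.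

(* Y is a left dual of X, i.e. Y = X^* with Y (x) X -> 1 and 1 -> X (x) Y;
   equivalently, X is a right dual of Y. *)
Definition is_dual X Y : Prop :=
  exists (ev : Hom (Y \ox X) (unit_obj C)) (coev : Hom (unit_obj C) (X \ox Y)),
    runit X \oc (ident X \ot ev) \oc assoc X Y X \oc (coev \ot ident X) = lunit X
    /\
    lunit Y \oc (ev \ot ident Y) \oc assocV Y X Y \oc (ident Y \ot coev) = runit Y.

Definition rigid : Prop :=
  forall X, (exists Y, is_dual X Y) /\ (exists Y, is_dual Y X).

Record is_fusion : Prop := {
  fusion_semisimple : semisimple_cat C;
  fusion_rigid : rigid;
  fusion_finite : finitely_many_simples C;
  fusion_End : forall S : C, simple_obj S -> bijective (fun c : k => c *: ident S);
  fusion_unit : simple_obj (unit_obj C)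
}.

Definition trivial_obj X : Prop := exists n, is_multiple n (unit_obj C) X.

Definition invertible_obj M : Prop :=
  exists N : C, iso (M \ox N) (unit_obj C) /\ iso (N \ox M) (unit_obj C).

Definition tpow X (n : nat) : C := iterop n tobj X (unit_obj C).

End MonCat.

Section FullSubcategory.
Variables (k : fieldType) (C : monCat k).
Variables (P : C -> Prop) (P1 : P (unit_obj C)).
Variable PM : forall X Y, P X -> P Y -> P (X \ox Y).

Implicit Types A B : {X : C | P X}.

Definition full_linCat : linCat k :=
  @LinCat k {X : C | P X} (fun A B => Hom (sval A) (sval B))
    (fun A => ident (sval A)) (fun _ _ _ g f => g \oc f)
    (fun _ _ f => mcomp1m f) (fun _ _ f => mcompm1 f)
    (fun _ _ _ _ h g f => mcompA h g f)
    (fun A _ _ g => @mcomp_linearr k C (sval A) _ _ g)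
    (fun _ _ B f => @mcomp_linearl k C _ _ (sval B) f).

Definition full_tobj A B : {X : C | P X} :=
  exist P (sval A \ox sval B) (PM (svalP A) (svalP B)).

Definition full_monCat : monCat k :=
  @MonCat k full_linCat full_tobj
    (fun A A' B B' f g => @thom k C (sval A) (sval A') (sval B) (sval B') f g)
    (fun A B => thom_id (sval A) (sval B))
    (fun _ _ _ _ _ _ g f g' f' => @thom_comp k C _ _ _ _ _ _ g f g' f')
    (fun A A' B B' g =>
       @thom_linearl k C (sval A) (sval A') (sval B) (sval B') g)
    (fun A A' B B' f =>
       @thom_linearr k C (sval A) (sval A') (sval B) (sval B') f)
    (exist P (unit_obj C) P1)
    (fun A B E => assoc (sval A) (sval B) (sval E))
    (fun A B E => assocV (sval A) (sval B) (sval E))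
    (fun A B E => assocK (sval A) (sval B) (sval E))
    (fun _ _ _ _ _ _ f g h => @assoc_nat k C _ _ _ _ _ _ f g h)
    (fun A => lunit (sval A)) (fun A => lunit_iso (sval A))
    (fun _ _ f => @lunit_nat k C _ _ f)
    (fun A => runit (sval A)) (fun A => runit_iso (sval A))
    (fun _ _ f => @runit_nat k C _ _ f)
    (fun A B E E' => pentagon (sval A) (sval B) (sval E) (sval E'))
    (fun A B => triangle (sval A) (sval B)).

End FullSubcategory.

Section Subcategories.
Variables (k : fieldType) (C : monCat k).
Implicit Types X Y : C.

Definition fusion_subcategory (D : C -> Prop) : Prop :=
  replete D /\
  exists (D1 : D (unit_obj C)) (DM : forall X Y, D X -> D Y -> D (X \ox Y)),
    is_fusion (full_monCat D1 DM).

Definition radical_subcat (D : C -> Prop) : C -> Prop :=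
  generated_by (fun X => exists2 n, (0 < n)%N & D (tpow X n)).

(* Duals are unique up to isomorphism, so when D is replete the choice of the
   dual Y = X^* is irrelevant. *)
Definition commutator_subcat (D : C -> Prop) : C -> Prop :=
  generated_by (fun X => exists2 Y, is_dual X Y & D (X \ox Y)).

End Subcategories.

Record fusionCat (k : fieldType) := FusionCat {
  fcat :> monCat k;
  fcatP : is_fusion fcat
}.

Record tensorFunctor (k : fieldType) (C D : monCat k) := TensorFunctor {
  fobj :> C -> D;
  fhom : forall X Y, Hom X Y -> Hom (fobj X) (fobj Y);
  fhom_id : forall X, fhom (ident X) = ident (fobj X);
  fhom_comp : forall X Y Z (g : Hom Y Z) (f : Hom X Y),
    fhom (g \oc f) = fhom g \oc fhom f;
  fhom_linear : forall X Y, linear (@fhom X Y);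
  ften : forall X Y, Hom (fobj X \ox fobj Y) (fobj (X \ox Y));
  ften_iso : forall X Y, is_iso (ften X Y);
  ften_nat : forall X X' Y Y' (f : Hom X X') (g : Hom Y Y'),
    ften X' Y' \oc (fhom f \ot fhom g) = fhom (f \ot g) \oc ften X Y;
  funit : Hom (unit_obj D) (fobj (unit_obj C));
  funit_iso : is_iso funit;
  ften_assoc : forall X Y Z,
    fhom (assoc X Y Z) \oc ften (X \ox Y) Z \oc (ften X Y \ot ident (fobj Z)) =
    ften X (Y \ox Z) \oc (ident (fobj X) \ot ften Y Z)
      \oc assoc (fobj X) (fobj Y) (fobj Z);
  ften_lunit : forall X,
    fhom (lunit X) \oc ften (unit_obj C) X \oc (funit \ot ident (fobj X)) =
    lunit (fobj X);
  ften_runit : forall X,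
    fhom (runit X) \oc ften X (unit_obj C) \oc (ident (fobj X) \ot funit) =
    runit (fobj X)
}.

Section TensorFunctor.
Variables (k : fieldType) (C C' : monCat k) (F : tensorFunctor C C').

Definition fker (X : C) : Prop := trivial_obj (F X).

Definition normal_functor : Prop :=
  forall X : C, simple_obj X -> direct_summand (unit_obj C') (F X) ->
  trivial_obj (F X).

Definition invertible_multiples : C -> Prop :=
  generated_by (fun X => exists M n, invertible_obj M /\ is_multiple n M (F X)).

End TensorFunctor.

Definition same_objects (T : Type) (A B : T -> Prop) : Prop :=
  forall X, A X <-> B X.

Definition normal_subcategory (k : fieldType) (C : monCat k) (D : C -> Prop)
    : Prop :=
  fusion_subcategory D /\
  exists (C' : fusionCat k) (G : tensorFunctor C C'),
    normal_functor G /\ same_objects D (fker G).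

(* Main.v *)
Require Import Defs.
From mathcomp Require Import all_boot all_algebra.
From Stdlib Require Import Classical FunctionalExtensionality PropExtensionality.
Import Defs.

(* For a simple object S of a fusion category, S* is simple and
   Hom(S (x) T, 1) = Hom(S, T* ), so a simple T with S (x) T trivial satisfies
   S (x) T = 1, and then also T (x) S = 1. Applied to the simple summands of
   F(X) and F(X* ), this shows that if X (x) X* lies in D = Ker F then F(X) is a
   multiple of an invertible M. Some power of M is 1, since the powers of M are
   simple and there are finitely many simples, so a power of X lies in D.
   Conversely, if V = X^n lies in D then so does its dual V', and X* is a summand
   of V' (x) X^(n-1), so X* (x) X is a summand of V' (x) V, which F trivializes. *)

Set Implicit Arguments.
Unset Strict Implicit.
Unset Printing Implicit Defensive.

Import GRing.Theory.
Local Open Scope ring_scope.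
Local Open Scope cat_scope.

(** Left and right are the main obstacle: no braiding or pivotal structure compares [S ⊗ T] with
    [T ⊗ S], or the left dual with the right one. When [S ⊗ T] is the unit, [S] is the dual of [T],
    and the zigzag identity shows that tensoring the coevaluation of [T] with [T] gives an
    isomorphism. Tensoring with a nonzero object is faithful, so the coevaluation is itself an
    isomorphism, which is the equation in the other order. Semisimplicity enters through von Neumann
    regularity: every mono and every epi splits. Objects can then be compared through retracts,
    which survive tensor products and tensor functors, and multiplicities never need to be counted.
    Of the three subcategories, only the one of invertible multiples is visibly closed under tensor
    products, since [M ⊗ N] is again invertible. It is the one proved to be fusion; the radical and
    the commutator inherit this once they are known to coincide with it. *)

Section Linearity.
Variables (k : fieldType) (U V : lmodType k) (f : U -> V).
Hypothesis f_lin : linear f.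

Lemma linearD_of u v : f (u + v) = f u + f v.
Proof. by rewrite -[u]scale1r f_lin !scale1r. Qed.

Lemma linear0_of : f 0 = 0.
Proof. by apply: (@addIr _ (f 0)); rewrite -linearD_of !add0r. Qed.

Lemma linearZ_of a u : f (a *: u) = a *: f u.
Proof. by rewrite -[a *: u]addr0 f_lin linear0_of addr0. Qed.

Lemma linearB_of u v : f (u - v) = f u - f v.
Proof. by rewrite linearD_of -scaleN1r linearZ_of scaleN1r. Qed.

Lemma linear_sum_of (I : finType) (g : I -> U) : f (\sum_i g i) = \sum_i f (g i).
Proof.
apply: (big_morph f linearD_of linear0_of).
Qed.
End Linearity.

(** * Isomorphisms and retracts in a linear category *)

Section LinCatTheory.
Variables (k : fieldType) (C : linCat k).
Implicit Types X Y Z : C.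

Lemma mcomp0r X Y Z (g : Hom Y Z) : g \oc (0 : Hom X Y) = 0.
Proof. exact: (linear0_of (mcomp_linearr g)). Qed.
Lemma mcomp0l X Y Z (f : Hom X Y) : (0 : Hom Y Z) \oc f = 0.
Proof. exact: (linear0_of (mcomp_linearl f)). Qed.
Lemma mcompDr X Y Z (g : Hom Y Z) (u v : Hom X Y) :
  g \oc (u + v) = (g \oc u) + (g \oc v).
Proof. exact: (linearD_of (mcomp_linearr g)). Qed.
Lemma mcompDl X Y Z (f : Hom X Y) (u v : Hom Y Z) :
  (u + v) \oc f = (u \oc f) + (v \oc f).
Proof. exact: (linearD_of (mcomp_linearl f)). Qed.
Lemma mcompBr X Y Z (g : Hom Y Z) (u v : Hom X Y) :
  g \oc (u - v) = (g \oc u) - (g \oc v).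
Proof. exact: (linearB_of (mcomp_linearr g)). Qed.
Lemma mcompBl X Y Z (f : Hom X Y) (u v : Hom Y Z) :
  (u - v) \oc f = (u \oc f) - (v \oc f).
Proof. exact: (linearB_of (mcomp_linearl f)). Qed.
Lemma mcompZr X Y Z (g : Hom Y Z) a (u : Hom X Y) :
  g \oc (a *: u) = a *: (g \oc u).
Proof. exact: (linearZ_of (mcomp_linearr g)). Qed.
Lemma mcompZl X Y Z (f : Hom X Y) a (u : Hom Y Z) :
  (a *: u) \oc f = a *: (u \oc f).
Proof. exact: (linearZ_of (mcomp_linearl f)). Qed.
Lemma mcomp_sumr X Y Z (g : Hom Y Z) (I : finType) (u : I -> Hom X Y) :
  g \oc (\sum_i u i) = \sum_i (g \oc u i).
Proof. exact: (linear_sum_of (mcomp_linearr g)). Qed.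
Lemma mcomp_suml X Y Z (f : Hom X Y) (I : finType) (u : I -> Hom Y Z) :
  (\sum_i u i) \oc f = \sum_i (u i \oc f).
Proof. exact: (linear_sum_of (mcomp_linearl f)). Qed.

Lemma is_zeroP X : is_zero X <-> ident X = 0.
Proof.
split=> [[h _]|h]; first exact: h.
split=> Y f g.
  by rewrite -[f]mcompm1 -[g]mcompm1 h !mcomp0r.
by rewrite -[f]mcomp1m -[g]mcomp1m h !mcomp0l.
Qed.

(** A direct summand without its complement: a single equation, preserved by every functor. *)
Definition retract X Y : Prop :=
  exists (i : Hom X Y) (r : Hom Y X), r \oc i = ident X.

Lemma iso_refl X : iso X X.
Proof. by exists (ident X), (ident X); split; rewrite mcomp1m. Qed.

Lemma iso_sym X Y : iso X Y -> iso Y X.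
Proof. by case=> f [g [h1 h2]]; exists g, f. Qed.

Lemma inverse_comp X Y Z (f : Hom X Y) f' (g : Hom Y Z) g' :
  inverse f f' -> inverse g g' -> inverse (g \oc f) (f' \oc g').
Proof.
move=> [a b] [c d]; split.
  by rewrite mcompA -(mcompA f') c mcompm1 a.
by rewrite mcompA -(mcompA g) b mcompm1 d.
Qed.

Lemma iso_trans Y X Z : iso X Y -> iso Y Z -> iso X Z.
Proof.
move=> [f [f' hf]] [g [g' hg]]; exists (g \oc f), (f' \oc g').
exact: inverse_comp.
Qed.

Lemma iso_retract X Y : iso X Y -> retract X Y.
Proof. by case=> f [g [h _]]; exists f, g. Qed.

Lemma retract_trans Y X Z : retract X Y -> retract Y Z -> retract X Z.
Proof.
move=> [i [r ri]] [j [s sj]]; exists (j \oc i), (r \oc s).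
by rewrite mcompA -(mcompA r) sj mcompm1.
Qed.

Lemma retract_zero X Y : retract X Y -> is_zero Y -> is_zero X.
Proof.
move=> [i [r ri]] /is_zeroP h; apply/is_zeroP.
by rewrite -ri -[i]mcomp1m h mcomp0l mcomp0r.
Qed.

Lemma iso_epi_cancel X Y Z (f : Hom X Y) (u v : Hom Y Z) :
  is_iso f -> u \oc f = v \oc f -> u = v.
Proof.
by case=> g [_ h] e; rewrite -[u]mcompm1 -[v]mcompm1 -h !mcompA e.
Qed.

Lemma iso_mono_cancel X Y Z (f : Hom Y Z) (u v : Hom X Y) :
  is_iso f -> f \oc u = f \oc v -> u = v.
Proof.
by case=> g [h _] e; rewrite -[u]mcomp1m -[v]mcomp1m -h -!mcompA e.
Qed.

Lemma is_iso_cancel X Y Z (g : Hom Y Z) (f : Hom X Y) :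
  is_iso g -> is_iso (g \oc f) -> is_iso f.
Proof.
move=> [g' [a b]] [h [c d]]; exists (h \oc g); split; first by rewrite -mcompA.
have -> : h = h \oc g \oc g' by rewrite -mcompA b mcompm1.
apply: (iso_mono_cancel (ex_intro _ g' (conj a b))).
by rewrite -(mcompA _ g') a !mcompA !mcompm1 d mcomp1m.
Qed.

End LinCatTheory.

(** * Coherence in monoidal categories and reversal of the tensor product *)

Section MonCatTheory.
Variables (k : fieldType) (C : monCat k).
Implicit Types A B W X Y Z : C.

Lemma thom0l X X' Y Y' (g : Hom Y Y') : (0 : Hom X X') \ot g = 0.
Proof. exact: (linear0_of (thom_linearl g)). Qed.
Lemma thom0r X X' Y Y' (f : Hom X X') : f \ot (0 : Hom Y Y') = 0.
Proof. exact: (linear0_of (thom_linearr f)). Qed.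
Lemma thomZl X X' Y Y' a (f : Hom X X') (g : Hom Y Y') :
  (a *: f) \ot g = a *: (f \ot g).
Proof. exact: (linearZ_of (thom_linearl g)). Qed.
Lemma thomZr X X' Y Y' a (f : Hom X X') (g : Hom Y Y') :
  f \ot (a *: g) = a *: (f \ot g).
Proof. exact: (linearZ_of (thom_linearr f)). Qed.
Lemma thom_suml X X' Y Y' (I : finType) (f : I -> Hom X X') (g : Hom Y Y') :
  (\sum_i f i) \ot g = \sum_i (f i \ot g).
Proof. exact: (linear_sum_of (thom_linearl g)). Qed.
Lemma thom_sumr X X' Y Y' (I : finType) (f : Hom X X') (g : I -> Hom Y Y') :
  f \ot (\sum_i g i) = \sum_i (f \ot g i).
Proof. exact: (linear_sum_of (thom_linearr f)). Qed.

Lemma thom_compl X X' X'' Y (g : Hom X' X'') (f : Hom X X') :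
  (g \oc f) \ot ident Y = (g \ot ident Y) \oc (f \ot ident Y).
Proof. by rewrite -thom_comp mcomp1m. Qed.
Lemma thom_compr X X' X'' Y (g : Hom X' X'') (f : Hom X X') :
  ident Y \ot (g \oc f) = (ident Y \ot g) \oc (ident Y \ot f).
Proof. by rewrite -thom_comp mcomp1m. Qed.
Lemma thom_lr X X' Y Y' (f : Hom X X') (g : Hom Y Y') :
  (f \ot ident Y') \oc (ident X \ot g) = f \ot g.
Proof. by rewrite -thom_comp mcomp1m mcompm1. Qed.
Lemma thom_rl X X' Y Y' (f : Hom X X') (g : Hom Y Y') :
  (ident X' \ot g) \oc (f \ot ident Y) = f \ot g.
Proof. by rewrite -thom_comp mcomp1m mcompm1. Qed.

Lemma assoc_iso X Y Z : is_iso (assoc X Y Z).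
Proof. by exists (assocV X Y Z); apply: assocK. Qed.

Lemma inverse_thom X X' Y Y' (f : Hom X X') f' (g : Hom Y Y') g' :
  inverse f f' -> inverse g g' -> inverse (f \ot g) (f' \ot g').
Proof.
by move=> [a b] [c d]; split; rewrite -thom_comp ?a ?b ?c ?d thom_id.
Qed.

Lemma is_iso_thom X X' Y Y' (f : Hom X X') (g : Hom Y Y') :
  is_iso f -> is_iso g -> is_iso (f \ot g).
Proof.
by move=> [f' hf] [g' hg]; exists (f' \ot g'); apply: inverse_thom.
Qed.

Lemma is_iso_id X : is_iso (ident X).
Proof. by exists (ident X); split; rewrite mcomp1m. Qed.

Lemma is_iso_comp X Y Z (g : Hom Y Z) (f : Hom X Y) :
  is_iso g -> is_iso f -> is_iso (g \oc f).
Proof.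
by move=> [g' hg] [f' hf]; exists (f' \oc g'); apply: inverse_comp.
Qed.

Lemma iso_thom X X' Y Y' : iso X X' -> iso Y Y' -> iso (X \ox Y) (X' \ox Y').
Proof. by move=> [f hf] [g hg]; exists (f \ot g); apply: is_iso_thom. Qed.

Lemma iso_assoc X Y Z : iso ((X \ox Y) \ox Z) (X \ox (Y \ox Z)).
Proof. by exists (assoc X Y Z); apply: assoc_iso. Qed.

Lemma iso_lunit X : iso (unit_obj C \ox X) X.
Proof. by exists (lunit X); apply: lunit_iso. Qed.
Lemma iso_runit X : iso (X \ox unit_obj C) X.
Proof. by exists (runit X); apply: runit_iso. Qed.

Lemma retract_thom X X' Y Y' :
  retract X X' -> retract Y Y' -> retract (X \ox Y) (X' \ox Y').
Proof.
move=> [i [r ri]] [j [s sj]]; exists (i \ot j), (r \ot s).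
by rewrite -thom_comp ri sj thom_id.
Qed.

Lemma thom_unit_inj X Y (f g : Hom X Y) :
  f \ot ident (unit_obj C) = g \ot ident (unit_obj C) -> f = g.
Proof.
by move=> e; apply: (iso_epi_cancel (runit_iso X)); rewrite -!runit_nat e.
Qed.

Lemma unit_thom_inj X Y (f g : Hom X Y) :
  ident (unit_obj C) \ot f = ident (unit_obj C) \ot g -> f = g.
Proof.
by move=> e; apply: (iso_epi_cancel (lunit_iso X)); rewrite -!lunit_nat e.
Qed.

Lemma assocV_nat X X' Y Y' Z Z' (f : Hom X X') (g : Hom Y Y') (h : Hom Z Z') :
  assocV X' Y' Z' \oc (f \ot (g \ot h)) = ((f \ot g) \ot h) \oc assocV X Y Z.
Proof.
apply: (iso_epi_cancel (assoc_iso X Y Z)).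
apply: (iso_mono_cancel (assoc_iso X' Y' Z')).
have [a b] := assocK X Y Z; have [a' b'] := assocK X' Y' Z'.
by rewrite -(mcompA _ (assocV X Y Z)) a mcompm1 mcompA mcompA b' mcomp1m assoc_nat.
Qed.

Lemma lunit_tensor X Y :
  lunit (X \ox Y) \oc assoc (unit_obj C) X Y = lunit X \ot ident Y.
Proof.
set I := unit_obj C.
(* Kelly's trick: after tensoring with the unit, pentagon and triangle apply. *)
apply: unit_thom_inj.
apply: (iso_epi_cancel (is_iso_comp (assoc_iso I (I \ox X) Y)
  (is_iso_thom (assoc_iso I I X) (is_iso_id Y)))).
rewrite [RHS]mcompA -assoc_nat -[RHS]mcompA -thom_compl triangle.
rewrite thom_compr -[LHS]mcompA (mcompA (ident I \ot assoc I X Y)) -pentagon.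
rewrite mcompA triangle.
by rewrite assoc_nat thom_id.
Qed.

(** Naturality of [lunit] along [lunit I] itself gives [lunit (I ⊗ I) = ident I ⊗ lunit I];
    [lunit_tensor] and the triangle then identify the two unitors after tensoring with [I]. *)
Lemma lunit_runit_unit : lunit (unit_obj C) = runit (unit_obj C).
Proof.
set I := unit_obj C.
apply: thom_unit_inj; rewrite -lunit_tensor -triangle; congr (_ \oc _).
by apply: (iso_mono_cancel (lunit_iso I)); rewrite lunit_nat.
Qed.

Lemma rev_pentagon W X Y Z :
  assocV (Z \ox Y) X W \oc assocV Z Y (X \ox W) =
  (assocV Z Y X \ot ident W) \oc assocV Z (Y \ox X) W
      \oc (ident Z \ot assocV Y X W).
Proof.
apply: (iso_epi_cancel (is_iso_comp (assoc_iso Z Y (X \ox W))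
  (assoc_iso (Z \ox Y) X W))).
have V1 A B D : assocV A B D \oc assoc A B D = ident _ by case: (assocK A B D).
rewrite [LHS]mcompA -(mcompA _ (assocV Z Y _)) V1 mcompm1 V1 pentagon !mcompA.
rewrite -(mcompA _ (ident Z \ot assocV _ _ _)) -thom_compr V1 thom_id mcompm1.
by rewrite -(mcompA _ (assocV Z _ W)) V1 mcompm1 -thom_compl V1 thom_id.
Qed.

Lemma rev_triangle X Y :
  (runit Y \ot ident X) \oc assocV Y (unit_obj C) X = ident Y \ot lunit X.
Proof.
rewrite -triangle -mcompA.
by case: (assocK Y (unit_obj C) X) => _ ->; rewrite mcompm1.
Qed.

(* Reversing the tensor product exchanges left and right duals, so every
   statement about one side yields its mirror image. *)
Definition rev_monCat : monCat k :=
  @MonCat k C (fun X Y => Y \ox X) (fun _ _ _ _ f g => g \ot f)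
    (fun X Y => thom_id Y X)
    (fun _ _ _ _ _ _ g f g' f' => thom_comp g' f' g f)
    (fun _ _ _ _ g => thom_linearr g) (fun _ _ _ _ f => thom_linearl f)
    (unit_obj C) (fun X Y Z => assocV Z Y X) (fun X Y Z => assoc Z Y X)
    (fun X Y Z => let: conj a b := assocK Z Y X in conj b a)
    (fun _ _ _ _ _ _ f g h => assocV_nat h g f)
    (fun X => runit X) (fun X => runit_iso X) (fun _ _ f => runit_nat f)
    (fun X => lunit X) (fun X => lunit_iso X) (fun _ _ f => lunit_nat f)
    rev_pentagon rev_triangle.

(** The same evaluation and coevaluation serve; the two zigzag identities trade places. *)
Lemma is_dual_rev X Y : is_dual (C := C) X Y -> is_dual (C := rev_monCat) Y X.
Proof. by case=> ev [coev [z1 z2]]; exists ev, coev. Qed.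
End MonCatTheory.

(** * Transposition along a duality *)

Section Duality.
Variables (k : fieldType) (C : monCat k).
Implicit Types A W X Y Z : C.

Lemma runit_tensor X Y :
  runit (X \ox Y) = (ident X \ot runit Y) \oc assoc X Y (unit_obj C).
Proof.
have <- : runit (X \ox Y) \oc assocV X Y (unit_obj C) = ident X \ot runit Y.
  exact: (@lunit_tensor k (rev_monCat C) Y X).
rewrite -mcompA; by case: (assocK X Y (unit_obj C)) => -> _; rewrite mcompm1.
Qed.

Section Zigzag.
Variables (X Y : C).
Variables (ev : Hom (Y \ox X) (unit_obj C)) (coev : Hom (unit_obj C) (X \ox Y)).
Hypothesis zigzagX :
  runit X \oc (ident X \ot ev) \oc assoc X Y X \oc (coev \ot ident X) = lunit X.
Hypothesis zigzagY :
  lunit Y \oc (ev \ot ident Y) \oc assocV Y X Y \oc (ident Y \ot coev) = runit Y.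

(** This is [zigzagX] tensored with [A] on the left, rebracketed by the pentagon into the shape that
    arises in [ev_surj]. *)
Lemma zigzag_tensor A :
  runit (A \ox X) \oc (ident (A \ox X) \ot ev) \oc assoc (A \ox X) Y X
    \oc (assocV A X Y \ot ident X) \oc ((ident A \ot coev) \ot ident X) =
  runit A \ot ident X.
Proof.
rewrite runit_tensor -thom_id -(mcompA (ident A \ot runit X)) assoc_nat.
rewrite mcompA -(mcompA _ _ (assoc (A \ox X) Y X)) pentagon.
rewrite -(mcompA _ _ (assocV A X Y \ot _)).
rewrite -(mcompA _ (assoc A X Y \ot _)) -thom_compl.
have [_ ->] := assocK A X Y; rewrite thom_id mcompm1.
rewrite (mcompA _ (ident A \ot assoc X Y X)) -(mcompA _ (assoc A (X \ox Y) X)).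
by rewrite assoc_nat !mcompA -!thom_compr zigzagX triangle.
Qed.

(** The preimage is the transpose of [p], namely [A ≅ A ⊗ 1 → A ⊗ (X ⊗ Y) ≅ (A ⊗ X) ⊗ Y → 1 ⊗ Y ≅
    Y], through [coev] and then [p]. Closing it with [ev] produces a zigzag on [X] that straightens
    to [p]. *)
Lemma ev_surj A (p : Hom (A \ox X) (unit_obj C)) :
  exists f : Hom A Y, ev \oc (f \ot ident X) = p.
Proof.
have [rV [rVr rrV]] := runit_iso A.
pose f0 := (p \ot ident Y) \oc assocV A X Y \oc (ident A \ot coev).
exists (lunit Y \oc f0 \oc rV).
apply: (iso_epi_cancel (is_iso_thom (runit_iso A) (is_iso_id X))).
rewrite -(mcompA ev) -thom_compl -(mcompA _ rV) rVr mcompm1 thom_compl.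
rewrite -lunit_tensor mcompA (mcompA ev) -lunit_nat /f0 !thom_compl.
rewrite -(mcompA _ (assoc _ _ _)) !mcompA.
rewrite -(mcompA _ (assoc _ _ _)) assoc_nat thom_id mcompA.
rewrite -(mcompA (lunit _)) thom_rl -thom_lr mcompA lunit_runit_unit runit_nat.
by rewrite -!mcompA; congr (_ \oc _); rewrite !mcompA zigzag_tensor.
Qed.

(** By the zigzag on [Y], transposing [ev \oc (f \ot ident X)] gives back [f], up to [runit A]; this
    yields injectivity. *)
Lemma ev_recover A (f : Hom A Y) :
  lunit Y \oc ((ev \oc (f \ot ident X)) \ot ident Y) \oc assocV A X Y
    \oc (ident A \ot coev) = f \oc runit A.
Proof.
rewrite thom_compl -!mcompA (mcompA ((f \ot _) \ot _)) -assocV_nat thom_id.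
by rewrite -mcompA thom_lr -(thom_rl f coev) !mcompA zigzagY runit_nat.
Qed.

Lemma ev_inj A (f g : Hom A Y) :
  ev \oc (f \ot ident X) = ev \oc (g \ot ident X) -> f = g.
Proof.
move=> e; apply: (iso_epi_cancel (runit_iso A)).
by rewrite -!ev_recover e.
Qed.

Lemma coev_eq0 : coev = 0 -> is_zero X.
Proof.
move=> c0; apply/is_zeroP; apply: (iso_epi_cancel (lunit_iso X)).
by rewrite mcomp1m mcomp0l -zigzagX c0 thom0l mcomp0r.
Qed.

Lemma ev_eq0 : ev = 0 -> is_zero X.
Proof.
move=> e0; apply/is_zeroP; apply: (iso_epi_cancel (lunit_iso X)).
by rewrite mcomp1m mcomp0l -zigzagX e0 thom0r mcomp0r !mcomp0l.
Qed.

(** In [zigzagX] every factor other than [coev ⊗ X] is then invertible, and the composite is the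
    isomorphism [lunit X]. *)
Lemma coev_thom_iso : is_iso ev -> is_iso (coev \ot ident X).
Proof.
move=> ev_iso.
have hg : is_iso (runit X \oc (ident X \ot ev) \oc assoc X Y X).
  apply: is_iso_comp (assoc_iso _ _ _); apply: is_iso_comp (runit_iso _) _.
  exact: is_iso_thom (is_iso_id _) ev_iso.
apply: (is_iso_cancel hg); rewrite zigzagX; exact: lunit_iso.
Qed.

End Zigzag.
End Duality.

(** * Components of direct sums, split kernels and cokernels *)

Section DirectSums.
Variables (k : fieldType) (C : linCat k).
Implicit Types X Y Z S T : C.

Lemma dsum_proj_neq0 (I : finType) (Z : I -> C) X T
    (p : forall i, Hom X (Z i)) (q : forall i, Hom (Z i) X) (f : Hom T X) :
  \sum_i (q i \oc p i) = ident X -> f != 0 -> exists i, p i \oc f != 0.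
Proof.
move=> s1 f0; apply/existsP; apply: contraNT f0 => /existsPn h.
rewrite -[f]mcomp1m -s1 mcomp_suml big1 // => i _.
by have /negPn/eqP e := h i; rewrite -mcompA e mcomp0r.
Qed.

Lemma dsum_inj_neq0 (I : finType) (Z : I -> C) X T
    (p : forall i, Hom X (Z i)) (q : forall i, Hom (Z i) X) (f : Hom X T) :
  \sum_i (q i \oc p i) = ident X -> f != 0 -> exists i, f \oc q i != 0.
Proof.
move=> s1 f0; apply/existsP; apply: contraNT f0 => /existsPn h.
rewrite -[f]mcompm1 -s1 mcomp_sumr big1 // => i _.
by have /negPn/eqP e := h i; rewrite mcompA e mcomp0l.
Qed.

Lemma is_dsum_iso (I : finType) (Y Z : I -> C) X :
  (forall i, iso (Y i) (Z i)) -> is_dsum Y X -> is_dsum Z X.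
Proof.
move=> hi [p [q [pq1 pq0 qp]]].
have [u hu] := fin_all_exists hi.
have [v hv] := fin_all_exists hu.
exists (fun i => u i \oc p i), (fun i => q i \oc v i); split=> [i|i j ne|].
- by rewrite mcompA -(mcompA (u i)) pq1 mcompm1; case: (hv i).
- by rewrite mcompA -(mcompA (u i)) pq0 // mcomp0r mcomp0l.
- rewrite -qp; apply: eq_bigr => i _; rewrite mcompA -(mcompA (q i)).
  by case: (hv i) => -> _; rewrite mcompm1.
Qed.

End DirectSums.

Section Kernels.
Variables (k : fieldType) (C : linCat k).
Implicit Types X Y K Q : C.

Lemma kernel_mono X Y (f : Hom X Y) K (i : Hom K X) : is_kernel f i -> mono i.
Proof.
move=> [fi hu] W u v e.
have z : f \oc (i \oc u) = 0 by rewrite mcompA fi mcomp0l.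
by have [w [_ wu]] := hu _ _ z; rewrite -(wu u) // -(wu v).
Qed.

Lemma cokernel_epi X Y (f : Hom X Y) Q (p : Hom Y Q) : is_cokernel f p -> epi p.
Proof.
move=> [pf hu] W u v e.
have z : u \oc p \oc f = 0 by rewrite -mcompA pf mcomp0r.
by have [w [_ wu]] := hu _ _ z; rewrite -(wu u) // -(wu v).
Qed.

Lemma split_mono_mono K X (i : Hom K X) (r : Hom X K) :
  r \oc i = ident K -> mono i.
Proof.
move=> ri W u v e; rewrite -[u]mcomp1m -[v]mcomp1m -ri.
by rewrite -!mcompA e.
Qed.

Lemma split_mono_kernel K X (i : Hom K X) (r : Hom X K) :
  r \oc i = ident K -> is_kernel (ident X - (i \oc r)) i.
Proof.
move=> ri; split=> [|T t].
  by rewrite mcompBl mcomp1m -mcompA ri mcompm1 subrr.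
rewrite mcompBl mcomp1m => /eqP; rewrite subr_eq0 => /eqP tE.
exists (r \oc t); split; first by rewrite mcompA -tE.
by move=> u <-; rewrite mcompA ri mcomp1m.
Qed.

Lemma split_epi_cokernel Y Q (p : Hom Y Q) (s : Hom Q Y) :
  p \oc s = ident Q -> is_cokernel (ident Y - (s \oc p)) p.
Proof.
move=> ps; split=> [|T t].
  by rewrite mcompBr mcompm1 mcompA ps mcomp1m subrr.
rewrite mcompBr mcompm1 => /eqP; rewrite subr_eq0 => /eqP tE.
exists (t \oc s); split; first by rewrite -mcompA -tE.
by move=> u <-; rewrite -mcompA ps mcompm1.
Qed.

End Kernels.

(** * Semisimple categories: regularity, splitting and isotypic objects *)

Section Semisimple.
Variables (k : fieldType) (C : linCat k).
Hypothesis ssC : semisimple_cat C.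
Implicit Types X Y Z S T : C.

Lemma schur_iso S T (f : Hom S T) :
  simple_obj S -> simple_obj T -> f != 0 -> is_iso f.
Proof.
move=> [_ sS] [_ sT] f0; have [ab _] := ssC.
have [K [i ki]] := abelian_kernel ab f; have [fi hu] := ki.
case: (sS _ _ (kernel_mono ki)) => [zK|[j [_ ij]]]; last first.
  by move: f0; rewrite -[f]mcompm1 -ij mcompA fi mcomp0l eqxx.
have fm : mono f.
  move=> W u v e; apply/eqP; rewrite -subr_eq0; apply/eqP.
  have z : f \oc (u - v) = 0 by rewrite mcompBr e subrr.
  by have [w [<- _]] := hu _ _ z; rewrite (zK.2 _ w 0) mcomp0r.
case: (sT _ _ fm) => // zS.
by move: f0; rewrite (zS.1 _ f 0) eqxx.
Qed.

(* Every morphism of a semisimple category is von Neumann regular; the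
   generalized inverse is built one simple summand of the source at a time. *)
Lemma regular X Y (f : Hom X Y) : exists g : Hom Y X, f \oc g \oc f = f.
Proof.
have [_ dec] := ssC.
have [n [S [sS [p [q [_ _ qp]]]]]] := dec X.
suff [r hr] : exists r : Hom Y X,
    forall a, a \in enum 'I_n -> f \oc r \oc f \oc q a = f \oc q a.
  exists r; rewrite -[LHS]mcompm1 -[RHS]mcompm1 -qp !mcomp_sumr.
  by apply: eq_bigr => a _; rewrite !mcompA hr ?mem_enum.
elim: (enum _) => [|b s [r hr]]; first by exists 0.
(* The defect of [r]: it vanishes on [f q_a] for the summands already treated, and [e f q_b] is what
   [r] misses on the new one. *)
pose e := ident Y - (f \oc r).
have er a : a \in s -> e \oc (f \oc q a) = 0.
  by move=> /hr h; rewrite mcompBl mcomp1m mcompA h subrr.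
have [j0|jn0] := eqVneq (e \oc (f \oc q b)) 0.
  exists r => a; rewrite inE => /orP[/eqP->|/hr //].
  by apply/eqP; rewrite -subr_eq0 -oppr_eq0 opprB -j0 mcompBl mcomp1m !mcompA.
have [m [T [sT [p' [q' [_ _ qp']]]]]] := dec Y.
have [i ni] := dsum_proj_neq0 qp' jn0.
have [t' [t't _]] := schur_iso (sS b) (sT i) ni.
pose t := t' \oc p' i.
have tj : t \oc (e \oc (f \oc q b)) = ident (S b) by rewrite /t -mcompA t't.
(* The correction [w t e] adds [f w = f q_b - f r f q_b] on the summand [b], because [t e f q_b] is
   the identity, and adds nothing on the earlier ones. *)
pose w := q b - (r \oc (f \oc q b)).
exists (r + (w \oc t \oc e)) => a; rewrite inE mcompDr 2!mcompDl.
have -> : f \oc (w \oc t \oc e) \oc f \oc q a =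
    f \oc w \oc (t \oc (e \oc (f \oc q a))).
  by rewrite !mcompA.
case: (boolP (a \in s)) => [as_ _|_].
  by rewrite er // !mcomp0r addr0 hr.
rewrite orbF => /eqP ->.
by rewrite tj mcompm1 mcompBr !mcompA addrC subrK.
Qed.

Lemma simple_exists X : ~ is_zero X -> exists2 T, simple_obj T & retract T X.
Proof.
move=> nz; have [_ dec] := ssC.
have [n [S [sS [p [q [pq _ qp]]]]]] := dec X.
have : ident X != 0 by apply/eqP => /is_zeroP.
by case/(dsum_proj_neq0 qp) => i _; exists (S i) => //; exists (q i), (p i).
Qed.

Lemma simple_neq0 S : simple_obj S -> ident S != 0.
Proof. by case=> nz _; apply/eqP => /is_zeroP. Qed.

(** From [f g f = f], the endomorphism [g f] of the simple [S] is nonzero, hence invertible. *)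
Lemma simple_split_mono S X (f : Hom S X) :
  simple_obj S -> f != 0 -> exists r, r \oc f = ident S.
Proof.
move=> sS f0; have [g fgf] := regular f.
have gf0 : g \oc f != 0.
  by apply: contra_neq f0 => e; rewrite -fgf -mcompA e mcomp0r.
have [h [hgf _]] := schur_iso sS sS gf0.
by exists (h \oc g); rewrite -mcompA.
Qed.

Lemma simple_split_epi S X (f : Hom X S) :
  simple_obj S -> f != 0 -> exists s, f \oc s = ident S.
Proof.
move=> sS f0; have [g fgf] := regular f.
have fg0 : f \oc g != 0.
  by apply: contra_neq f0 => e; rewrite -fgf e mcomp0l.
have [h [_ fgh]] := schur_iso sS sS fg0.
by exists (g \oc h); rewrite mcompA.
Qed.

Lemma simple_retract S X (f : Hom S X) : simple_obj S -> f != 0 -> retract S X.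
Proof. by move=> sS /(simple_split_mono sS) [r rf]; exists f, r. Qed.

Lemma mono_split X Y (f : Hom X Y) : mono f -> exists r, r \oc f = ident X.
Proof.
move=> fm; have [g fgf] := regular f; exists g; apply: fm.
by rewrite mcompA fgf mcompm1.
Qed.

Lemma epi_split X Y (f : Hom X Y) : epi f -> exists s, f \oc s = ident Y.
Proof.
move=> fe; have [g fgf] := regular f; exists g; apply: fe.
by rewrite fgf mcomp1m.
Qed.

(** A subobject splits, so it corresponds to an idempotent of [X]; a scalar idempotent is 0 or 1,
    giving a zero subobject or all of [X]. *)
Lemma simple_of_scalar_End X :
  ~ is_zero X -> (forall f : Hom X X, exists c : k, f = c *: ident X) ->
  simple_obj X.
Proof.
move=> nz sc; split=> // Y f /mono_split [g gf].
have [c hc] := sc (f \oc g).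
have [c0|c0] := eqVneq c 0; [left|right].
  apply/is_zeroP; rewrite -gf -[f]mcompm1 -gf (mcompA f) hc c0 scale0r.
  by rewrite mcomp0l mcomp0r.
exists g; split=> //; rewrite hc.
have : f \oc g \oc (f \oc g) = f \oc g by rewrite mcompA -(mcompA f) gf mcompm1.
rewrite hc mcompZl mcomp1m => /(congr1 (fun u => c^-1 *: u)).
by rewrite !scalerA mulVf // mul1r scale1r.
Qed.

Lemma simple_iso S T : simple_obj S -> iso S T -> simple_obj T.
Proof.
move=> [nz sS] [f [g [gf fg]]]; split.
  by move=> zT; apply: nz; apply: (retract_zero _ zT); exists f, g.
move=> Y h hm; have ig : is_iso g by exists f.
have gm : mono (g \oc h).
  move=> W u v; rewrite -!mcompA => /(iso_mono_cancel ig); exact: hm.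
by case: (sS _ _ gm) => [|gh]; [left|right; apply: is_iso_cancel ig gh].
Qed.

(** For simple [S] this amounts to [X] being a multiple of [S]. Mentioning neither a multiplicity
    nor a decomposition, it passes to retracts at once and covers zero objects. *)
Definition isotypic (S X : C) : Prop := forall T (f : Hom T X),
  simple_obj T -> f != 0 -> iso T S.

Lemma multiple_isotypic n S X : simple_obj S -> is_multiple n S X -> isotypic S X.
Proof.
move=> sS [p [q [_ _ qp]]] T f sT /(dsum_proj_neq0 qp) [i ni].
by exists (p i \oc f); apply: schur_iso.
Qed.

Lemma isotypic_multiple S X : isotypic S X -> exists n, is_multiple n S X.
Proof.
move=> iX; have [_ dec] := ssC; have [n [Y [sY dX]]] := dec X; exists n.
have [p [q [pq _ _]]] := dX; apply: is_dsum_iso dX => i.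
apply: (iX _ (q i)) => //; apply: contra_neq (simple_neq0 (sY i)) => q0.
by rewrite -pq q0 mcomp0r.
Qed.

Lemma isotypic_retract S X Y : retract X Y -> isotypic S Y -> isotypic S X.
Proof.
move=> [i [r ri]] iY T f sT f0; apply: (iY _ (i \oc f)) => //.
by apply: contra_neq f0 => e; rewrite -[f]mcomp1m -ri -mcompA e mcomp0r.
Qed.

Lemma isotypic_iso S S' X : iso S S' -> isotypic S X -> isotypic S' X.
Proof. by move=> e h T f sT f0; apply: iso_trans e; apply: h f0. Qed.

Lemma isotypic_simple S : simple_obj S -> isotypic S S.
Proof. by move=> sS T f sT f0; exists f; apply: schur_iso. Qed.

Lemma isotypic_zero S X : is_zero X -> isotypic S X.
Proof. by move=> zX T f _; rewrite (zX.2 _ f 0) eqxx. Qed.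

Lemma isotypic_simple_iso S T : simple_obj T -> isotypic S T -> iso T S.
Proof. by move=> sT h; apply: (h _ (ident T)) => //; apply: simple_neq0. Qed.

Lemma isotypic_nonzero S X : ~ is_zero X -> isotypic S X -> retract S X.
Proof.
move=> nz iX; have [T sT rT] := simple_exists nz.
apply: (retract_trans _ rT); apply: iso_retract; apply: iso_sym.
by apply: isotypic_simple_iso => //; apply: isotypic_retract iX.
Qed.

(** Trades the chosen decomposition for a test on all simples mapping nontrivially to [X]; closure
    properties of [generated_by] are then checked on simples. *)
Lemma generated_byP (Q : C -> Prop) X : replete Q ->
  generated_by Q X <-> forall T (f : Hom T X), simple_obj T -> f != 0 -> Q T.
Proof.
move=> rQ; split=> [[n [Y [hY [p [q [_ _ qp]]]]]] T f sT|h].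
  case/(dsum_proj_neq0 qp) => i ni; have [S [sS QS YS]] := hY i.
  have sY := simple_iso sS (iso_sym YS).
  apply: rQ QS; apply: iso_trans (iso_sym YS) (iso_sym _).
  by exists (p i \oc f); apply: schur_iso.
have [_ dec] := ssC; have [n [Y [sY dX]]] := dec X; exists n, Y; split=> // i.
exists (Y i); split=> //; last exact: iso_refl.
have [p [q [pq _ _]]] := dX; apply: (h _ (q i)) => //.
by apply: contra_neq (simple_neq0 (sY i)) => q0; rewrite -pq q0 mcomp0r.
Qed.

End Semisimple.

(** * Evaluations as perfect pairings; fusion categories under reversal *)

Section Pairing.
Variables (k : fieldType) (C : monCat k).
Implicit Types A X Y : C.

(** The evaluation as a representing element on both sides: [Hom(A, Y) = Hom(A ⊗ X, 1)] and
    [Hom(A, X) = Hom(Y ⊗ A, 1)]. The coevaluation is no longer mentioned. *)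
Definition pairing X Y (ev : Hom (Y \ox X) (unit_obj C)) : Prop :=
  [/\ forall A (f g : Hom A Y),
        ev \oc (f \ot ident X) = ev \oc (g \ot ident X) -> f = g,
      forall A p, exists f : Hom A Y, ev \oc (f \ot ident X) = p,
      forall A (f g : Hom A X),
        ev \oc (ident Y \ot f) = ev \oc (ident Y \ot g) -> f = g
    & forall A p, exists f : Hom A X, ev \oc (ident Y \ot f) = p].

Lemma dual_pairing X Y : is_dual X Y ->
  exists ev : Hom (Y \ox X) (unit_obj C), pairing ev.
Proof.
move=> [ev [coev [z1 z2]]]; exists ev; split=> A.
- exact: (ev_inj z2).
- exact: (ev_surj z1).
- exact: (@ev_inj k (rev_monCat C) Y X ev coev z1).
- exact: (@ev_surj k (rev_monCat C) Y X ev coev z2).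
Qed.

Lemma pairing_neq0 X Y (ev : Hom (Y \ox X) (unit_obj C)) :
  pairing ev -> ~ is_zero X -> ev != 0.
Proof.
move=> [_ _ inj _] nz; apply/eqP => e0; apply: nz; apply/is_zeroP; apply: inj.
by rewrite e0 !mcomp0l.
Qed.

End Pairing.

Lemma is_fusion_rev (k : fieldType) (C : monCat k) :
  is_fusion C -> is_fusion (rev_monCat C).
Proof.
move=> [ss rg fin End1 sI]; split=> // X; have [[Y hY] [Z hZ]] := rg X.
by split; [exists Z | exists Y]; apply: is_dual_rev.
Qed.

(** * Simple, trivial and invertible objects of a fusion category *)

Section FusionTheory.
Variables (k : fieldType) (C : monCat k).
Hypothesis fC : is_fusion C.
Implicit Types A B M N S T W X Y : C.

Let ssC : semisimple_cat C := fusion_semisimple fC.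
Let sI : simple_obj (unit_obj C) := fusion_unit fC.

Lemma simple_Hom_scalar S T (f g : Hom S T) :
  simple_obj S -> simple_obj T -> g != 0 -> exists c, f = c *: g.
Proof.
move=> sS sT g0; have [h [_ gh]] := schur_iso ssC sS sT g0.
have [d _ dK] := fusion_End fC sS.
by exists (d (h \oc f)); rewrite -[g]mcompm1 -mcompZr dK mcompA gh mcomp1m.
Qed.

Lemma dual_nonzero X Y : is_dual X Y -> ~ is_zero X -> ~ is_zero Y.
Proof.
move=> /dual_pairing [ev hev] nz [_ zY]; have := pairing_neq0 hev nz.
rewrite -[ev]mcompm1 -thom_id (zY _ (ident Y) 0) thom0l.
by rewrite mcomp0r eqxx.
Qed.

(** The two halves of the pairing identify [End X] and [End Y] with [Hom(Y ⊗ X, 1)], so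
    endomorphisms of [Y] are scalars because those of [X] are. *)
Lemma dual_simple X Y : is_dual X Y -> simple_obj X -> simple_obj Y.
Proof.
move=> dXY sX; apply: (simple_of_scalar_End ssC).
  by apply: dual_nonzero dXY _; case: sX.
move=> f; have [ev [inj _ _ surj]] := dual_pairing dXY.
have [g hg] := surj _ (ev \oc (f \ot ident X)).
have [c gc] := simple_Hom_scalar g sX sX (simple_neq0 sX).
exists c; apply: inj; rewrite -hg gc thomZl thomZr //.
Qed.

Lemma unit_retract X Y :
  is_dual X Y -> ~ is_zero X -> retract (unit_obj C) (X \ox Y).
Proof.
move=> [ev [coev [z1 _]]] nz; apply: (simple_retract ssC (f := coev)) => //.
by apply/eqP => c0; apply: nz; apply: (coev_eq0 z1).
Qed.

(** Tensoring further with a dual [Y] of [X] makes the unit a retract of [X ⊗ Y], and tensoring with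
    the unit is faithful. *)
Lemma thom_faithful X A B (f g : Hom A B) :
  ~ is_zero X -> f \ot ident X = g \ot ident X -> f = g.
Proof.
move=> nz e; have [[Y dXY] _] := fusion_rigid fC X.
have [s [r rs]] := unit_retract dXY nz.
apply: thom_unit_inj.
have e2 : f \ot ident (X \ox Y) = g \ot ident (X \ox Y).
  apply: (iso_epi_cancel (assoc_iso A X Y)).
  by rewrite -!thom_id -!assoc_nat e.
have h (u : Hom A B) : u \ot ident (unit_obj C) =
    (ident B \ot r) \oc (u \ot ident (X \ox Y)) \oc (ident A \ot s).
  by rewrite -!thom_comp mcomp1m !mcompm1 rs.
by rewrite !h e2.
Qed.

Lemma tensor_nonzero X Y : ~ is_zero X -> ~ is_zero Y -> ~ is_zero (X \ox Y).
Proof.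
move=> nX nY /is_zeroP z; apply: nX; apply/is_zeroP; apply: (thom_faithful nY).
by rewrite thom_id thom0l.
Qed.

(** With [U] dual to [T], [Hom(S ⊗ T, 1) = Hom(S, U)] is at most one-dimensional. All projections of
    [S ⊗ T] onto copies of the unit are multiples of one split epi [r], so the identity factors
    through [r] and [r] is invertible. *)
Lemma simple_unit_tensor S T : simple_obj S -> simple_obj T ->
  isotypic (unit_obj C) (S \ox T) -> iso (S \ox T) (unit_obj C).
Proof.
move=> sS sT iST; have [[U dTU] _] := fusion_rigid fC T.
have [ev hev] := dual_pairing dTU; have [_ surj _ _] := hev.
have sU := dual_simple dTU sT.
have nz : ~ is_zero (S \ox T) by apply: tensor_nonzero; [case: sS | case: sT].
have [i [r ri]] := isotypic_nonzero ssC nz iST.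
have [n [p [q [pq pq0 qp]]]] := isotypic_multiple ssC iST.
have [f fr] := surj _ r.
have f0 : f != 0.
  apply: contra_neq (simple_neq0 sI) => f0.
  by rewrite -ri -fr f0 thom0l mcomp0r mcomp0l.
have pr a : exists c, p a = c *: r.
  have [g gp] := surj _ (p a); have [c gc] := simple_Hom_scalar g sS sU f0.
  by exists c; rewrite -gp gc thomZl mcompZr fr.
have [c hc] := fin_all_exists pr.
exists r, i; split=> //.
have ls : (\sum_a c a *: q a) \oc r = ident _.
  by rewrite mcomp_suml -qp; apply: eq_bigr => a _; rewrite hc mcompZr mcompZl.
by rewrite -[i \oc r]mcomp1m -ls -mcompA (mcompA r) ri mcomp1m.
Qed.

Lemma simple_unit_tensor_sym S T : simple_obj S -> simple_obj T ->
  iso (S \ox T) (unit_obj C) -> iso (T \ox S) (unit_obj C).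
Proof.
move=> sS sT iST; have [[U dTU] _] := fusion_rigid fC T.
have sU := dual_simple dTU sT.
have iSU : iso S U.
  have [ev [_ surj _ _]] := dual_pairing dTU; have [r [i [ir ri]]] := iST.
  have [f fr] := surj _ r; exists f; apply: (schur_iso ssC) => //.
  apply: contra_neq (simple_neq0 sI) => f0.
  by rewrite -ri -fr f0 thom0l mcomp0r mcomp0l.
have sUT : simple_obj (U \ox T).
  apply: simple_iso sI (iso_sym _).
  apply: iso_trans iST; apply: iso_thom (iso_sym iSU) (iso_refl _).
apply: iso_trans (iso_thom (iso_refl T) iSU) _.
have nT : ~ is_zero T by case: sT.
have [ev0 [coev [z1 z2]]] := dTU.
have iev : is_iso ev0.
  apply: (schur_iso ssC) => //; apply/eqP => e0.
  exact: nT (ev_eq0 z1 e0).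
have c0 : coev != 0 by apply/eqP => c0; apply: nT (coev_eq0 z1 c0).
have [r rc] := simple_split_mono ssC sI c0.
(* [r] was only a left inverse of [coev]. The other composite is compared with the identity after
   tensoring with [T], where [coev ⊗ T] is invertible and cancels. *)
exists r, coev; split=> //; apply: (thom_faithful nT).
apply: (iso_epi_cancel (coev_thom_iso z1 iev)).
by rewrite -thom_compl -mcompA rc mcompm1 thom_id mcomp1m.
Qed.

(** Reduces questions about what occurs in [X ⊗ Y] to tensor products of simple summands. *)
Lemma tensor_neq0 X Y T (f : Hom T (X \ox Y)) : f != 0 ->
  exists S S', [/\ simple_obj S, simple_obj S', retract S X, retract S' Y
    & exists g : Hom T (S \ox S'), g != 0].
Proof.
move=> f0; have [_ dec] := ssC.
have [n [S [sS [p [q [pq _ qp]]]]]] := dec X.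
have [n' [S' [sS' [p' [q' [pq' _ qp']]]]]] := dec Y.
have s1 : \sum_i ((q i \ot ident Y) \oc (p i \ot ident Y)) = ident (X \ox Y).
  by rewrite -thom_id -qp thom_suml; apply: eq_bigr => i _; rewrite thom_compl.
have [i ni] := dsum_proj_neq0 s1 f0.
have s2 : \sum_j ((ident (S i) \ot q' j) \oc (ident (S i) \ot p' j)) =
    ident (S i \ox Y).
  by rewrite -thom_id -qp' thom_sumr; apply: eq_bigr => j _; rewrite thom_compr.
have [j nj] := dsum_proj_neq0 s2 ni.
exists (S i), (S' j); split=> //.
- by exists (q i), (p i).
- by exists (q' j), (p' j).
- by exists ((ident (S i) \ot p' j) \oc ((p i \ot ident Y) \oc f)).
Qed.

Lemma trivial_objP X : trivial_obj X <-> isotypic (unit_obj C) X.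
Proof.
split=> [[n]|]; last exact: isotypic_multiple.
exact: multiple_isotypic.
Qed.

Lemma tensor_trivial_sym A B : isotypic (unit_obj C) (A \ox B) ->
  isotypic (unit_obj C) (B \ox A).
Proof.
move=> iAB T f sT /tensor_neq0 [S' [S [sS' sS rB rA [g g0]]]].
have iSS : isotypic (unit_obj C) (S \ox S').
  by apply: isotypic_retract iAB; apply: retract_thom.
have iso1 := simple_unit_tensor_sym sS sS' (simple_unit_tensor sS sS' iSS).
apply: (iso_trans _ iso1); exists g; apply: (schur_iso ssC) => //.
exact: simple_iso sI (iso_sym iso1).
Qed.

(** Fix one simple summand [T] of [B]: every simple summand of [A] is a two-sided inverse of [T],
    and inverses are unique, [S ≅ S ⊗ (T ⊗ M) ≅ (S ⊗ T) ⊗ M ≅ M]. *)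
Lemma isotypic_of_tensor_trivial A B : ~ is_zero B ->
  isotypic (unit_obj C) (A \ox B) -> exists2 M, invertible_obj M & isotypic M A.
Proof.
move=> nB iAB; have [T sT rT] := simple_exists ssC nB.
have key S : simple_obj S -> retract S A ->
    iso (S \ox T) (unit_obj C) /\ iso (T \ox S) (unit_obj C).
  move=> sS rS; have h : iso (S \ox T) (unit_obj C).
    apply: simple_unit_tensor => //; apply: isotypic_retract iAB.
    exact: retract_thom.
  by split=> //; apply: simple_unit_tensor_sym.
have [/eqP/is_zeroP zA|/eqP nA] := boolP (ident A == 0).
  (* A zero [A] is isotypic of every type, so any invertible object would do. *)
  exists (unit_obj C); last exact: isotypic_zero.
  by exists (unit_obj C); split; apply: iso_lunit.
have [|M sM rM] := @simple_exists k C ssC A; first by move/is_zeroP.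
have [MT TM] := key _ sM rM.
exists M; first by exists T.
move=> S f sS f0; have [ST TS] := key _ sS (simple_retract ssC sS f0).
apply: iso_trans (iso_sym (iso_runit S)) _.
apply: iso_trans (iso_thom (iso_refl S) (iso_sym TM)) _.
apply: iso_trans (iso_sym (iso_assoc _ _ _)) _.
exact: iso_trans (iso_thom ST (iso_refl M)) (iso_lunit M).
Qed.

Lemma invertible_cancel M A B :
  invertible_obj M -> iso (M \ox A) (M \ox B) -> iso A B.
Proof.
move=> [N [_ NM]] h.
have e X : iso X (N \ox (M \ox X)).
  apply: iso_trans (iso_sym (iso_lunit X)) _.
  exact: iso_trans (iso_thom (iso_sym NM) (iso_refl X)) (iso_assoc _ _ _).
apply: iso_trans (e A) (iso_trans (iso_thom (iso_refl N) h) (iso_sym (e B))).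
Qed.

(** For [f] in [End M], [f ⊗ N] is an endomorphism of [M ⊗ N ≅ 1], hence a scalar; faithfulness of
    tensoring with [N] makes [f] that scalar. *)
Lemma invertible_simple M : invertible_obj M -> simple_obj M.
Proof.
move=> [N [MN NM]].
have z A B : iso (A \ox B) (unit_obj C) -> ~ is_zero A.
  move=> /iso_sym/iso_retract rAB /is_zeroP zA.
  case: sI => nI _; apply: nI; apply: (retract_zero rAB).
  by apply/is_zeroP; rewrite -thom_id zA thom0l.
have sMN := simple_iso sI (iso_sym MN).
apply: (simple_of_scalar_End ssC (z _ _ MN)) => f.
have [c hc] := simple_Hom_scalar (f \ot ident N) sMN sMN (simple_neq0 sMN).
exists c; apply: (thom_faithful (z _ _ NM)).
by rewrite hc thomZl thom_id.
Qed.

Lemma invertible_unit : invertible_obj (unit_obj C).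
Proof. by exists (unit_obj C); split; apply: iso_lunit. Qed.

Lemma invertible_tensor M N : invertible_obj M -> invertible_obj N ->
  invertible_obj (M \ox N).
Proof.
have h A B A' B' : iso (A \ox A') (unit_obj C) -> iso (B \ox B') (unit_obj C) ->
    iso ((A \ox B) \ox (B' \ox A')) (unit_obj C).
  move=> hA hB; apply: iso_trans hA.
  apply: iso_trans (iso_assoc _ _ _) _; apply: iso_thom (iso_refl A) _.
  apply: iso_trans (iso_sym (iso_assoc _ _ _)) _.
  exact: iso_trans (iso_thom hB (iso_refl _)) (iso_lunit _).
by move=> [M' [a b]] [N' [c d]]; exists (N' \ox M'); split; apply: h.
Qed.

Lemma isotypic_tensor M N A B : invertible_obj M -> invertible_obj N ->
  isotypic M A -> isotypic N B -> isotypic (M \ox N) (A \ox B).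
Proof.
move=> iM iN iA iB T f sT /tensor_neq0 [S [S' [sS sS' rA rB [g g0]]]].
have e : iso (S \ox S') (M \ox N).
  apply: iso_thom; apply: isotypic_simple_iso => //.
    exact: isotypic_retract iA.
  exact: isotypic_retract iB.
apply: (iso_trans _ e); exists g; apply: (schur_iso ssC) => //.
apply: simple_iso _ (iso_sym e).
by apply: invertible_simple; apply: invertible_tensor.
Qed.

(** Only an isomorphism: [iterop] makes [tpow X 1] equal to [X], not to [X ⊗ 1]. *)
Lemma tpowS X n : iso (tpow X n.+1) (X \ox tpow X n).
Proof.
case: n => [|n]; last exact: iso_refl.
exact: iso_sym (iso_runit X).
Qed.

Lemma tpowSr X n : iso (tpow X n.+1) (tpow X n \ox X).
Proof.
elim: n => [|n IHn]; first exact: iso_sym (iso_lunit X).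
apply: iso_trans (tpowS X n.+1) _; apply: iso_trans (iso_thom (iso_refl X) IHn) _.
apply: iso_trans (iso_sym (iso_assoc _ _ _)) _.
exact: iso_thom (iso_sym (tpowS X n)) (iso_refl X).
Qed.

Lemma tpow_nonzero X n : ~ is_zero X -> ~ is_zero (tpow X n).
Proof.
move=> nX; elim: n => [|n IHn]; first by case: sI.
move=> z; apply: (tensor_nonzero nX IHn).
exact: retract_zero (iso_retract (iso_sym (tpowS X n))) z.
Qed.

Lemma tpow_invertible M n : invertible_obj M -> invertible_obj (tpow M n).
Proof.
move=> iM; case: n => [|n]; first exact: invertible_unit.
by elim: n => [//|n IHn]; apply: invertible_tensor.
Qed.

Lemma tpow_isotypic M A n : invertible_obj M -> isotypic M A ->
  isotypic (tpow M n) (tpow A n).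
Proof.
move=> iM iA; case: n => [|n]; first exact: isotypic_simple.
elim: n => [//|n IHn].
exact: (isotypic_tensor iM (tpow_invertible n.+1 iM) iA IHn).
Qed.

Lemma invertible_torsion M : invertible_obj M ->
  exists2 n, (0 < n)%N & iso (tpow M n) (unit_obj C).
Proof.
move=> iM; have [N [S hS]] := fusion_finite fC.
(* Pigeonhole: [N.+1] exponents, starting from 0, against [N] representatives of simples. *)
have hN (i : 'I_N.+1) : exists a, iso (tpow M i) (S a).
  exact/hS/invertible_simple/tpow_invertible.
have [a ha] := fin_all_exists hN.
have /injectivePn [i [j ij eqa]] : ~~ injectiveb a.
  by apply/negP => /injectiveP /leq_card; rewrite !card_ord ltnn.
wlog ltij : i j ij eqa / (i < j)%N.
  move=> H; case: (ltngtP i j) => h; first exact: (H i j).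
    by apply: (H j i) => //; rewrite eq_sym.
  by move/eqP: ij; case; apply: val_inj.
exists (j - i)%N; first by rewrite subn_gt0.
have : iso (tpow M (j - i + i)) (tpow M i).
  rewrite subnK; last exact: ltnW.
  by apply: iso_trans (ha j) (iso_sym _); rewrite -eqa; apply: ha.
(* The difference [m] stays fixed while induction on the smaller exponent [n] cancels one factor [M]
   at a time. *)
move: (nat_of_ord i) (j - i)%N => n m.
elim: n => [|n IHn]; first by rewrite addn0.
rewrite addnS => h. apply: IHn; apply: (invertible_cancel iM).
exact: iso_trans (iso_sym (tpowS M _)) (iso_trans h (tpowS M n)).
Qed.

End FusionTheory.

(** * Full subcategories that are fusion *)

Section FullFusion.
Variables (k : fieldType) (C : monCat k).
Hypothesis fC : is_fusion C.
Variable E : C -> Prop.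
Hypotheses (E1 : E (unit_obj C)) (EM : forall X Y, E X -> E Y -> E (X \ox Y)).
Hypothesis E_retract : forall X Y, retract X Y -> E Y -> E X.
Hypothesis E_dsum : forall (I : finType) (Y : I -> C) X,
  is_dsum Y X -> (forall i, E (Y i)) -> E X.
Hypothesis E_dual : forall X Y, is_dual X Y -> E X -> E Y.
Hypothesis E_predual : forall X Y, is_dual Y X -> E X -> E Y.

Let D := full_monCat E1 EM.
Let ssC : semisimple_cat C := fusion_semisimple fC.
Implicit Types A B : D.

(** A mono of [D] is tested only against objects of [D], so it is not at first a mono of [C]. The
    equation [f r f = f] involves only [A] and [B], hence can be cancelled inside [D]. *)
Lemma full_mono_split A B (f : Hom A B) :
  mono f -> exists r : Hom B A, r \oc f = ident A.
Proof.
move=> fm; have [r frf] := regular ssC (X := sval A) (Y := sval B) f.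
exists (r : Hom B A); apply: fm.
by rewrite mcompA mcompm1; exact: frf.
Qed.

Lemma full_epi_split A B (f : Hom A B) :
  epi f -> exists s : Hom B A, f \oc s = ident B.
Proof.
move=> fm; have [r frf] := regular ssC (X := sval A) (Y := sval B) f.
exists (r : Hom B A); apply: fm.
by rewrite mcomp1m; exact: frf.
Qed.

Lemma full_zero A : is_zero A <-> is_zero (sval A).
Proof. by rewrite !is_zeroP. Qed.

(** If [A] is simple in [D], a simple retract of it in [C] lies in [E], so it is a nonzero subobject
    in [D] and must be all of [A]. *)
Lemma full_simple A : simple_obj A <-> simple_obj (sval A).
Proof.
split=> [[nz sA]|[nz sA]]; last first.
  split=> [/full_zero //|B f /full_mono_split [r rf]].
  have fm := @split_mono_mono k C (sval B) (sval A) f r rf.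
  by case: (sA _ _ fm) => [zB|h]; [left; apply/full_zero | right].
have [|T sT rT] := @simple_exists k C ssC (sval A); first by move/full_zero.
have [i [r ri]] := rT.
pose T' : D := exist E T (E_retract rT (svalP A)).
have im := @split_mono_mono k D T' A i r ri.
case: (sA _ _ im) => [/full_zero zT|[j hj]]; first by case: sT.
by apply: simple_iso sT _; exists i, j.
Qed.

(** Kernels and cokernels are those of [C]: they split, so they are retracts and stay in [E]. A
    split mono or epi comes from its complementary idempotent. *)
Lemma full_abelian : abelian_cat D.
Proof.
have [ab _] := ssC; split.
- move=> I Y; have [X dX] := abelian_additive ab (fun i => sval (Y i)).
  by exists (exist E X (E_dsum dX (fun i => svalP (Y i)))).
- move=> A B f; have [K [i hi]] := abelian_kernel ab (X := sval A) (Y := sval B) f.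
  have [r ri] := mono_split ssC (kernel_mono hi).
  have rKA : retract K (sval A) by exists i, r.
  exists (exist E K (E_retract rKA (svalP A))), i; case: hi => fi hu.
  by split=> // T t; apply: hu.
- move=> A B f; have [Q [p hp]] := abelian_cokernel ab (X := sval A) (Y := sval B) f.
  have [s ps] := epi_split ssC (cokernel_epi hp).
  have rQB : retract Q (sval B) by exists s, p.
  exists (exist E Q (E_retract rQB (svalP B))), p; case: hp => pf hu.
  by split=> // T t; apply: hu.
- move=> K A i /full_mono_split [r ri].
  by exists A, (ident A - (i \oc r)); apply: split_mono_kernel.
- move=> A Q p /full_epi_split [s ps].
  by exists A, (ident A - (s \oc p)); apply: split_epi_cokernel.
Qed.

Lemma full_fusion : is_fusion D.
Proof.
have sD : forall A, simple_obj A -> simple_obj (sval A) by move=> A /full_simple.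
have sD' X (EX : E X) : simple_obj X -> @simple_obj k D (exist E X EX).
  by move=> sX; apply/(full_simple (exist E X EX)).
split.
- split; first exact: full_abelian.
  move=> A; have [_ dec] := ssC; have [n [Y [sY dY]]] := dec (sval A).
  have EY i : E (Y i).
    have [p [q [pq _ _]]] := dY; apply: (E_retract _ (svalP A)).
    by exists (q i), (p i).
  exists n, (fun i => exist E (Y i) (EY i)); split=> // i.
  exact: sD'.
- move=> A; have [[Y dY] [Z dZ]] := fusion_rigid fC (sval A).
  split; first by exists (exist E Y (E_dual dY (svalP A))).
  by exists (exist E Z (E_predual dZ (svalP A))).
- have [n [S hS]] := fusion_finite fC.
  (* Representatives outside [E] are replaced by the unit, a placeholder: only indices with
     [E (S i)] are consulted. *)
  have hS' (i : 'I_n) : exists A : D, E (S i) -> sval A = S i.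
    case: (classic (E (S i))) => [h|h]; last by exists (unit_obj D).
    by exists (exist E (S i) h).
  have [S' eS'] := fin_all_exists hS'.
  exists n, S' => A /sD /hS [i hi]; exists i.
  have ESi : E (S i).
    by apply: E_retract (svalP A); apply: iso_retract; apply: iso_sym.
  have : iso (sval A) (sval (S' i)) by rewrite eS'.
  by case=> f hf; exists f.
- by move=> A /sD /(fusion_End fC).
- by apply: sD'; apply: fusion_unit fC.
Qed.

End FullFusion.

(** * Tensor functors on retracts, powers and nonzero objects *)

Section FunctorTheory.
Variables (k : fieldType) (C C' : monCat k) (F : tensorFunctor C C').
Implicit Types X Y : C.

Lemma tensor_functor_retract X Y : retract X Y -> retract (F X) (F Y).
Proof.
move=> [i [r ri]]; exists (fhom F i), (fhom F r).
by rewrite -fhom_comp ri fhom_id.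
Qed.

Lemma tensor_functor_iso X Y : iso X Y -> iso (F X) (F Y).
Proof.
move=> [f [g [gf fg]]]; exists (fhom F f), (fhom F g).
by split; rewrite -fhom_comp ?gf ?fg fhom_id.
Qed.

Lemma tensor_functor_tensor X Y : iso (F X \ox F Y) (F (X \ox Y)).
Proof. by exists (ften F X Y); apply: ften_iso. Qed.

Lemma tensor_functor_unit : iso (unit_obj C') (F (unit_obj C)).
Proof. by exists (funit F); apply: funit_iso. Qed.

Lemma tensor_functor_tpow X n : iso (tpow (F X) n) (F (tpow X n)).
Proof.
elim: n => [|n IHn]; first exact: tensor_functor_unit.
apply: iso_trans (tpowS _ _) _.
apply: iso_trans (iso_thom (iso_refl _) IHn) _.
apply: iso_trans (tensor_functor_tensor _ _) _.
exact: tensor_functor_iso (iso_sym (tpowS X n)).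
Qed.

(** The unit is a retract of [X ⊗ Y] for a dual [Y], so the unit of [C'] is a retract of
    [F X ⊗ F Y], which would vanish with [F X]. *)
Lemma tensor_functor_nonzero X : is_fusion C -> is_fusion C' ->
  ~ is_zero X -> ~ is_zero (F X).
Proof.
move=> fC fC' nX /is_zeroP zFX; have [[Y dXY] _] := fusion_rigid fC X.
have /tensor_functor_retract r1 := unit_retract fC dXY nX.
have [nz _] := fusion_unit fC'; apply: nz.
apply: retract_zero (iso_retract tensor_functor_unit) _; apply: retract_zero r1 _.
apply: retract_zero (iso_retract (iso_sym (tensor_functor_tensor X Y))) _.
by apply/is_zeroP; rewrite -thom_id zFX thom0l.
Qed.

End FunctorTheory.

(** * Duals of summands, and fusion subcategories generated by simples *)

Section DualSummands.
Variables (k : fieldType) (C : monCat k).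
Hypothesis fC : is_fusion C.
Implicit Types S T W X Y : C.
Let ssC : semisimple_cat C := fusion_semisimple fC.

Lemma simple_iso_dual X Y T (p : Hom (T \ox X) (unit_obj C)) :
  simple_obj X -> simple_obj T -> is_dual X Y -> p != 0 -> iso T Y.
Proof.
move=> sX sT dXY p0; have [ev [_ surj _ _]] := dual_pairing dXY.
have [f fp] := surj _ p; exists f; apply: (schur_iso ssC) => //.
  exact (dual_simple fC dXY sX).
by apply: contra_neq p0 => f0; rewrite -fp f0 thom0l mcomp0r.
Qed.

(** The transpose of [f] is a nonzero pairing of [T] with [X], hence with some simple summand of
    [X]. With [simple_iso_dual], simple summands of a dual are duals of simple summands. *)
Lemma dual_summand X Y T (f : Hom T Y) : is_dual X Y -> f != 0 ->
  exists S, [/\ simple_obj S, retract S X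
              & exists p : Hom (T \ox S) (unit_obj C), p != 0].
Proof.
move=> dXY f0; have [ev [inj _ _ _]] := dual_pairing dXY.
have p0 : ev \oc (f \ot ident X) != 0.
  apply: contra_neq f0 => e; apply: inj; by rewrite e thom0l mcomp0r.
have [_ dec] := ssC; have [n [S [sS [p [q [pq _ qp]]]]]] := dec X.
have s1 : \sum_i ((ident T \ot q i) \oc (ident T \ot p i)) = ident (T \ox X).
  by rewrite -thom_id -qp thom_sumr; apply: eq_bigr => i _; rewrite thom_compr.
have [i ni] := dsum_inj_neq0 s1 p0; exists (S i); split=> //.
  by exists (q i), (p i).
by exists (ev \oc (f \ot ident X) \oc (ident T \ot q i)).
Qed.

End DualSummands.

Section FusionSubcategory.
Variables (k : fieldType) (C : monCat k).
Hypothesis fC : is_fusion C.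
Let ssC : semisimple_cat C := fusion_semisimple fC.
Variable Q : C -> Prop.
Hypotheses (Q_replete : replete Q) (Q1 : Q (unit_obj C)).
Hypothesis Q_tensor : forall S S' T (f : Hom T (S \ox S')), simple_obj S ->
  simple_obj S' -> simple_obj T -> Q S -> Q S' -> f != 0 -> Q T.
Hypothesis Q_dual : forall S T, simple_obj S -> is_dual S T -> Q S -> Q T.

(** Left and right duals of a simple agree: the splitting of [1 → X ⊗ Y] is a nonzero pairing
    [X ⊗ Y → 1], and such pairings are represented by [W]. *)
Lemma predual_iso_dual (X Y W : C) :
  simple_obj X -> is_dual X Y -> is_dual W X -> iso Y W.
Proof.
move=> sX dXY dWX; have nX : ~ is_zero X by case: sX.
have [i [r ri]] := unit_retract fC dXY nX.
have sW : simple_obj W := dual_simple (is_fusion_rev fC) (is_dual_rev dWX) sX.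
apply: (@simple_iso_dual k (rev_monCat C) (is_fusion_rev fC) X W Y r) => //.
- exact: dual_simple dXY sX.
- exact: is_dual_rev.
- apply: contra_neq (simple_neq0 (fusion_unit fC)) => r0.
  by rewrite -ri r0 mcomp0l.
Qed.

(** Every closure condition is tested on simple summands. [Q_dual] speaks of duals on one side; the
    other side follows from [predual_iso_dual]. *)
Lemma fusion_subcategory_generated_by : fusion_subcategory (generated_by Q).
Proof.
have gP := fun X => generated_byP ssC X Q_replete.
have gr X Y : retract X Y -> generated_by Q Y -> generated_by Q X.
  move=> [i [r ri]] /gP hY; apply/gP => T f sT f0; apply: (hY _ (i \oc f)) => //.
  by apply: contra_neq f0 => e; rewrite -[f]mcomp1m -ri -mcompA e mcomp0r.
have gs S X : simple_obj S -> retract S X -> generated_by Q X -> Q S.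
  move=> sS [i [r ri]] /gP h; apply: (h _ i) => //.
  by apply: contra_neq (simple_neq0 sS) => i0; rewrite -ri i0 mcomp0r.
split; first by move=> X Y /iso_sym/iso_retract; apply: gr.
have g1 : generated_by Q (unit_obj C).
  apply/gP => T f sT f0; apply: Q_replete Q1; apply: iso_sym.
  by exists f; apply: (schur_iso ssC) => //; apply: fusion_unit fC.
have gM X Y : generated_by Q X -> generated_by Q Y -> generated_by Q (X \ox Y).
  move=> gX gY; apply/gP => T f sT /(tensor_neq0 fC).
  move=> [S [S' [sS sS' rS rS' [g g0]]]].
  by apply: (Q_tensor sS sS' sT _ _ g0); [apply: gs gX | apply: gs gY].
exists g1, gM; apply: full_fusion => //.
- move=> I Y X [p [q [_ _ qp]]] gY; apply/gP => T f sT f0.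
  have [i ni] := dsum_proj_neq0 qp f0.
  by have /gP h := gY i; apply: h ni.
- move=> X Y dXY gX; apply/gP => T f sT f0.
  have [S [sS rS [p p0]]] := dual_summand fC dXY f0.
  have [[W dSW] _] := fusion_rigid fC S.
  have iTW := simple_iso_dual fC sS sT dSW p0.
  apply: Q_replete (iso_sym iTW) _; apply: Q_dual dSW _ => //.
  exact: gs gX.
- move=> X Y dYX gX; apply/gP => T f sT f0.
  have [S [sS rS [p p0]]] :=
    @dual_summand k (rev_monCat C) (is_fusion_rev fC) X Y T f (is_dual_rev dYX) f0.
  have [[W dSW] [W' dWS]] := fusion_rigid fC S.
  have iTW : iso T W'.
    apply: (@simple_iso_dual k (rev_monCat C) (is_fusion_rev fC) S W' T p) => //.
    exact: is_dual_rev.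
  have iWW := predual_iso_dual sS dSW dWS.
  apply: Q_replete (iso_trans iWW (iso_sym iTW)) _; apply: Q_dual dSW _ => //.
  exact: gs gX.
Qed.

End FusionSubcategory.

(** * Kernel, torsion and commutator of a tensor functor *)

Section KernelRadical.
Variables (k : fieldType) (C C' : monCat k) (F : tensorFunctor C C').
Hypotheses (fC : is_fusion C) (fC' : is_fusion C').
Variable D : C -> Prop.
Hypotheses (D_fusion : fusion_subcategory D) (D_ker : same_objects D (fker F)).
Implicit Types S T X Y : C.
Let ssC : semisimple_cat C := fusion_semisimple fC.
Let ssC' : semisimple_cat C' := fusion_semisimple fC'.

Definition inv_isotypic X : Prop :=
  exists2 M, invertible_obj M & isotypic M (F X).

Lemma inv_isotypicP X : inv_isotypic X <->
  exists M n, invertible_obj M /\ is_multiple n M (F X).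
Proof.
split=> [[M iM /(isotypic_multiple ssC') [n h]]|[M [n [iM h]]]].
  by exists M, n.
exists M => //; apply: multiple_isotypic h => //; exact: invertible_simple iM.
Qed.

Lemma inv_isotypic_retract X Y : retract X Y -> inv_isotypic Y -> inv_isotypic X.
Proof.
move=> r [M iM h]; exists M => //.
by apply: isotypic_retract h; apply: tensor_functor_retract.
Qed.

Lemma kernelP X : D X <-> isotypic (unit_obj C') (F X).
Proof. by rewrite D_ker; apply: trivial_objP. Qed.

Lemma kernel_tensorP X Y :
  D (X \ox Y) <-> isotypic (unit_obj C') (F X \ox F Y).
Proof.
rewrite kernelP; have e := tensor_functor_tensor F X Y.
by split; apply: isotypic_retract; apply: iso_retract => //; apply: iso_sym.
Qed.

Lemma kernel_tensor_sym X Y : D (X \ox Y) -> D (Y \ox X).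
Proof. by move/kernel_tensorP/(tensor_trivial_sym fC')/kernel_tensorP. Qed.

Lemma kernel_tensor_inv X Y : ~ is_zero Y -> D (X \ox Y) -> inv_isotypic X.
Proof.
move=> nY /kernel_tensorP; apply: isotypic_of_tensor_trivial => //.
exact: tensor_functor_nonzero.
Qed.

Lemma inv_isotypic_torsion X :
  inv_isotypic X -> exists2 n, (0 < n)%N & D (tpow X n).
Proof.
move=> [M iM iMX]; have [n n0 Mn] := invertible_torsion fC' iM; exists n => //.
apply/kernelP; apply: isotypic_retract (isotypic_iso Mn (tpow_isotypic fC' iM iMX)).
apply: iso_retract; apply: iso_sym; exact: tensor_functor_tpow.
Qed.

(* If V' is dual to V = X^n, the evaluation (V' X^(n-1)) X -> 1 exhibits X^* as
   a summand of V' X^(n-1), so that X^* X is a summand of V' V. *)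
Lemma torsion_commutator X Y n : simple_obj X -> is_dual X Y -> (0 < n)%N ->
  D (tpow X n) -> D (X \ox Y).
Proof.
(* From here [n] is one less than the exponent: [V] is [tpow X n.+1] and the remaining factor is
   [tpow X n]. *)
case: n => // n sX dXY _ DV; have nX : ~ is_zero X by case: sX.
have [_ [D1 [DM fD]]] := D_fusion.
have [[[V' DV'] dV] _] := fusion_rigid fD (exist D _ DV).
(* Rigidity of [D] supplies a dual inside [D]; the Hom spaces being those of [C], it is a dual in
   [C] by conversion. *)
have {}dV : is_dual (tpow X n.+1) V' by [].
have [ev hev] := dual_pairing dV.
have ev0 := pairing_neq0 hev (tpow_nonzero fC (n := n.+1) nX).
have [u [v [vu uv]]] : iso ((V' \ox tpow X n) \ox X) (V' \ox tpow X n.+1).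
  apply: iso_trans (iso_assoc _ _ _) _.
  exact: iso_thom (iso_refl _) (iso_sym (tpowSr X n)).
have [ev' [_ surj _ _]] := dual_pairing dXY.
have [f fE] := surj _ (ev \oc u).
have f0 : f != 0.
  apply: contra_neq ev0 => f0.
  by rewrite -[ev]mcompm1 -uv mcompA -fE f0 thom0l mcomp0r mcomp0l.
(* The transpose [f] of the evaluation is nonzero with simple target [Y], so it splits and exhibits
   [Y] as a retract. *)
have [s fs] := simple_split_epi ssC (dual_simple fC dXY sX) f0.
apply: kernel_tensor_sym; apply/kernelP.
have /kernelP := DM _ _ DV' DV; apply: isotypic_retract.
apply: tensor_functor_retract.
apply: (retract_trans (Y := (V' \ox tpow X n) \ox X)).
  apply: retract_thom (iso_retract (iso_refl X)); by exists s, f.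
by exists u, v.
Qed.

(** Passing through a power of [X] in [D] puts [X ⊗ Y], then [Y ⊗ X], in [D], so [F Y] is read off
    without dualizing [F X]. *)
Lemma inv_isotypic_dual X Y :
  simple_obj X -> is_dual X Y -> inv_isotypic X -> inv_isotypic Y.
Proof.
move=> sX dXY /inv_isotypic_torsion [n n0 Dn].
have /kernel_tensor_sym := torsion_commutator sX dXY n0 Dn.
by apply: kernel_tensor_inv; case: sX.
Qed.

Lemma fusion_subcategory_invertible_multiples :
  fusion_subcategory (invertible_multiples F).
Proof.
apply: fusion_subcategory_generated_by => //.
- move=> X Y /iso_sym/iso_retract r /inv_isotypicP h; apply/inv_isotypicP.
  exact: inv_isotypic_retract h.
- apply/inv_isotypicP; exists (unit_obj C'); first exact: invertible_unit.
  apply: isotypic_retract (isotypic_simple ssC' (fusion_unit fC')).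
  by apply: iso_retract; apply: iso_sym; apply: tensor_functor_unit.
- move=> S S' T f sS sS' sT /inv_isotypicP [M iM hM] /inv_isotypicP [N iN hN] f0.
  apply/inv_isotypicP; apply: inv_isotypic_retract (simple_retract ssC sT f0) _.
  exists (M \ox N); first exact: invertible_tensor.
  apply: isotypic_retract (isotypic_tensor fC' iM iN hM hN).
  by apply: iso_retract; apply: iso_sym; apply: tensor_functor_tensor.
- move=> X Y sX dXY /inv_isotypicP h; apply/inv_isotypicP.
  exact: inv_isotypic_dual dXY h.
Qed.

End KernelRadical.

Lemma generated_by_sub (k : fieldType) (C : linCat k) (P Q : C -> Prop) X :
  (forall S, simple_obj S -> P S -> Q S) -> generated_by P X -> generated_by Q X.
Proof.
move=> PQ [n [Y [hY dX]]]; exists n, Y; split=> // i.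
by have [S [sS PS iS]] := hY i; exists S; split=> //; apply: PQ.
Qed.

(** The category inside [fusion_subcategory] is built from the predicate itself, so the property is
    transported by rewriting an equality of predicates. *)
Lemma same_objects_eq (T : Type) (A B : T -> Prop) : same_objects A B -> A = B.
Proof.
move=> e; apply: functional_extensionality => X.
by apply: propositional_extensionality.
Qed.

Theorem proposition6p1 (k : fieldType) (C : fusionCat k) (D : C -> Prop)
    (hD : normal_subcategory D)
    (C' : fusionCat k) (F : tensorFunctor C C')
    (hF : same_objects D (fker F)) :
  [/\ same_objects (commutator_subcat D) (radical_subcat D),
      same_objects (radical_subcat D) (invertible_multiples F),
      fusion_subcategory (commutator_subcat D)
    & fusion_subcategory (radical_subcat D)].
Proof.
have [fD _] := hD; have fC := fcatP C; have fC' := fcatP C'.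
have co_rad : same_objects (commutator_subcat D) (radical_subcat D).
  move=> X; split; apply: generated_by_sub => S sS.
    move=> [Y dSY DSY]; apply: (inv_isotypic_torsion fC' hF).
    apply: (kernel_tensor_inv fC fC' hF) DSY.
    by apply: dual_nonzero dSY _ => //; case: sS.
  move=> [n n0 Dn]; have [[Y dSY] _] := fusion_rigid fC S; exists Y => //.
  exact: (torsion_commutator fC fC' fD hF sS dSY n0 Dn).
have rad_inv : same_objects (radical_subcat D) (invertible_multiples F).
  move=> X; split; apply: generated_by_sub => S sS; last first.
    by move/(inv_isotypicP F fC')/(inv_isotypic_torsion fC' hF).
  move=> [n n0 Dn]; apply/(inv_isotypicP F fC').
  have [[Y dSY] _] := fusion_rigid fC S.
  have DSY := torsion_commutator fC fC' fD hF sS dSY n0 Dn.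
  apply: (kernel_tensor_inv fC fC' hF) DSY.
  by apply: dual_nonzero dSY _ => //; case: sS.
split=> //; rewrite ?(same_objects_eq co_rad) (same_objects_eq rad_inv).
- exact: (fusion_subcategory_invertible_multiples fC fC' fD hF).
- exact: (fusion_subcategory_invertible_multiples fC fC' fD hF).
Qed.
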